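(* For every non-negative integer $L$, \[ \sum_{m,n\geq 0} \frac{q^{2m^2+6mn+6n^2}(q;q)_L}{(q;q)_{L-3n-2m}(q;q)_m(q^3;q^3)_n} = \sum_{j=-L}^{L}\left(\frac{j+1}{3}\right) q^{j^2}{2L\brack L-j}_q, \] and \[ \sum_{m,n\geq 0} \frac{q^{2m^2+6mn+6n^2+m+3n}(q;q)_L}{(q;q)_{L-3n-2m}(q;q)_m(q^3;q^3)_n} + q\sum_{m,n\geq 0} \frac{q^{2m^2+6mn+6n^2+3m+6n}(q;q)_L}{(q;q)_{L-3n-2m-1}(q;q)_m(q^3;q^3)_n} = \sum_{j=-L}^{L}\left(\frac{j+1}{3}\right) q^{j(j+1)}{2L\brack L-j}_q. \]
   Context: For a variable $a$ and a non-negative integer $n$, $(a;q)_n=\prod_{k=0}^{n-1}(1-aq^k)$. By convention $1/(q;q)_n=0$ and $1/(q^3;q^3)_n=0$ for negative integers $n$ (so summands with a negative index in a denominator vanish). The $q$-binomial coefficient is ${m+n\brack m}_q=\frac{(q;q)_{m+n}}{(q;q)_m(q;q)_n}$ for $m,n\ge 0$ and $0$ otherwise. $\left(\frac{a}{3}\right)$ denotes the Jacobi symbol modulo 3: it is $0$ if $3\mid a$, $1$ if $a\equiv 1 \pmod 3$, and $-1$ if $a\equiv 2\pmod 3$. *)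

(* Defs.v *)
From HB Require Import structures.
From mathcomp Require Import all_boot all_order all_algebra.
From mathcomp Require Import mathcomp_extra boolp classical_sets functions.
From mathcomp Require Import cardinality fsbigop.

Set Implicit Arguments.
Unset Strict Implicit.
Unset Printing Implicit Defensive.

Import Order.TTheory GRing.Theory Num.Theory.

Local Open Scope classical_set_scope.
Local Open Scope ring_scope.

Definition qpoch (F : fieldType) (a q : F) (n : nat) : F :=
  \prod_(k < n) (1 - a * q ^+ k).

(* 1/(q;q)_n, with the convention that it is 0 for negative n. *)
Definition qpoch_inv (F : fieldType) (q : F) (n : int) : F :=
  match n with
  | Posz k => (qpoch q q k)^-1
  | Negz _ => 0
  end.

(* The coefficient [N over m]_q, where N = m + n; it is 0 unless m, n >= 0. *)
Definition qbinom (F : fieldType) (q : F) (N m : int) : F :=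
  match m, (N - m)%R with
  | Posz m', Posz n' =>
      qpoch q q (m' + n') / (qpoch q q m' * qpoch q q n')
  | _, _ => 0
  end.

Definition jacobi3 (a : int) : int :=
  if (3 %| a)%Z then 0 else if (a == 1 %[mod 3])%Z then 1 else -1.

(* Finite support of the double sums: \sum_(p \in A) is 0 by default when the
   support is infinite, and this shows that the default value is never used. *)
Lemma finite_support_qsum (F : fieldType) (q : F) (L d : nat)
    (f : nat -> nat -> F) :
  finite_set ([set: nat * nat] `&`
    (fun p : nat * nat => let: (m, n) := p in
       f m n * qpoch_inv q (L%:Z - (3 * n)%:Z - (2 * m)%:Z - d%:Z)
         * qpoch_inv q m%:Z * qpoch_inv (q ^+ 3) n%:Z) @^-1` [set~ 0]).
Proof.
apply: (@sub_finite_set _ _ (`I_L.+1 `*` `I_L.+1)); last exact: finite_setX.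
move=> [m n] [_ /=] Hne.
suff H : (3 * n + 2 * m + d <= L)%N.
  split; rewrite /= ltnS; apply: leq_trans H.
    by rewrite -addnA addnCA -addnA mulSn -addnA leq_addr.
  by rewrite mulSn -!addnA leq_addr.
rewrite leqNgt; apply/negP => Hlt; apply: Hne.
have -> : L%:Z - (3 * n)%:Z - (2 * m)%:Z - d%:Z
    = Negz (3 * n + 2 * m + d - L).-1.
  rewrite NegzE prednK ?subn_gt0// -subzn ?(ltnW Hlt)//.
  by rewrite !PoszD opprB !opprD !addrA.
by rewrite /= mulr0 !mul0r.
Qed.

(* Main.v *)
Require Import Defs.
From HB Require Import structures.
From mathcomp Require Import all_boot all_order all_algebra.
From mathcomp Require Import mathcomp_extra boolp classical_sets functions.
From mathcomp Require Import cardinality fsbigop.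
From mathcomp Require Import zify ring.

Set Implicit Arguments.
Unset Strict Implicit.
Unset Printing Implicit Defensive.

Import Order.TTheory GRing.Theory Num.Theory.

Local Open Scope classical_set_scope.
Local Open Scope ring_scope.

(** Write [w j] for the weight (j+1 / 3); only [w (j-1) + w j + w (j+1) = 0]
    matters, i.e. [w] behaves like powers of a primitive cube root of unity z.
    Three uses of the q-Vandermonde sum give, for arbitrary weights,
    \sum_j w j q^(j^2) [2L, L-j]
      = \sum_(r, s) w (s - r) q^(r^2 + s^2 - r s) [L, r] [L, s]
      = \sum_(a, b, c, d) w (b - c) q^(...) (q;q)_L /
          ((q;q)_(L-a-b-c-2d) (q;q)_a (q;q)_b (q;q)_c (q;q)_d),
    with r = a + c + d and s = a + b + d.  The sum over a + b + c = k is a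
    coefficient of (-x;q)_oo (-zx;q)_oo (-x/z;q)_oo = (-x^3;q^3)_oo, which is
    nonzero only for k = 3n and leaves the double sum over m = d and n.
    For the second identity the same argument is applied to the weights
    [w j + w (-1-j)], whose product is
    (-xq;q)_oo (-zxq;q)_oo (-x/z;q)_oo = (1 + x/z) (-x^3 q^3;q^3)_oo; this
    produces the right-hand side with [2L+1, L-j], and the difference with
    [2L, L-j] vanishes by antisymmetry of [w (j - 1)]. *)

(** * q-binomial coefficients and q-Vandermonde sums *)

(** Defined by a q-Pascal recursion, not a quotient, so that it vanishes for [k > n] without side
    conditions. Where the subtraction [n' - k'] truncates, the factor [qbin q n' k'] is already
    0. *)
Fixpoint qbin (F : fieldType) (q : F) (n k : nat) : F :=
  match n, k with
  | _, 0 => 1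
  | 0, _.+1 => 0
  | n'.+1, k'.+1 => qbin q n' k'.+1 + q ^+ (n' - k') * qbin q n' k'
  end.

Definition qpochV (F : fieldType) (q : F) (n : nat) : F := (qpoch q q n)^-1.

Section QBinomials.
Variables (F : fieldType) (q : F).
Hypothesis qN1 : forall k : nat, (0 < k)%N -> q ^+ k <> 1.

Lemma subr1_expS_neq0 n : 1 - q ^+ n.+1 != 0.
Proof. by rewrite subr_eq0 eq_sym; apply/eqP/qN1. Qed.

Lemma qpochS n : qpoch q q n.+1 = qpoch q q n * (1 - q ^+ n.+1).
Proof. by rewrite /qpoch big_ord_recr /= -exprS. Qed.

Lemma qpoch_neq0 n : qpoch q q n != 0.
Proof.
elim: n => [|n IHn]; first by rewrite /qpoch big_ord0 oner_neq0.
by rewrite qpochS mulf_neq0 // subr1_expS_neq0.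
Qed.

Lemma qpochV0 : qpochV q 0 = 1.
Proof. by rewrite /qpochV /qpoch big_ord0 invr1. Qed.

Lemma qpochVS n : qpochV q n = (1 - q ^+ n.+1) * qpochV q n.+1.
Proof.
rewrite /qpochV qpochS; field.
by rewrite qpoch_neq0 subr1_expS_neq0.
Qed.

Lemma qpochK n : qpoch q q n * qpochV q n = 1.
Proof. by rewrite /qpochV divff // qpoch_neq0. Qed.

Lemma qbin_small n k : (n < k)%N -> qbin q n k = 0.
Proof.
elim: n k => [|n IHn] [|k] //= nk.
by rewrite !IHn ?mulr0 ?addr0 // ltnW.
Qed.

Lemma qbinn0 n : qbin q n 0 = 1. Proof. by case: n. Qed.

Lemma qbinE n k : (k <= n)%N ->
  qbin q n k = qpoch q q n * qpochV q k * qpochV q (n - k).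
Proof.
elim: n k => [|n IHn] [|k] //=.
- by rewrite qpochV0 !mulr1 /qpoch big_ord0.
- by rewrite qpochV0 mulr1 subn0 qpochK.
rewrite ltnS leq_eqVlt => /predU1P[->|kn].
  by rewrite qbin_small // IHn // !subnn add0r mul1r qpochV0 !mulr1 !qpochK.
rewrite !IHn // ?(ltnW kn) //.
(* Over the common factor [qpochV q k.+1 * qpochV q (n - k)] the claim becomes (1 - q^(n-k)) +
   q^(n-k) (1 - q^(k+1)) = 1 - q^(n+1). *)
have -> : (n - k = (n - k.+1).+1)%N by lia.
rewrite (qpochVS k) (qpochVS (n - k.+1)) qpochS subSS subnSK //.
have -> : q ^+ n.+1 = q ^+ (n - k) * q ^+ k.+1 by rewrite -exprD; congr (_ ^+ _); lia.
ring.
Qed.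

(** The dual q-Pascal rule, read off the closed form: q^(k+1) (1 - q^(n-k)) + (1 - q^(k+1)) = 1 -
    q^(n+1). *)
Lemma qbinSr n k :
  qbin q n.+1 k.+1 = q ^+ k.+1 * qbin q n k.+1 + qbin q n k.
Proof.
have [nk|kn] := ltnP n k; first by rewrite !qbin_small ?mulr0 ?addr0 //; lia.
move: kn; rewrite leq_eqVlt => /predU1P[->|kn].
  by rewrite /= subnn mul1r (@qbin_small n) // mulr0.
rewrite !qbinE //; try lia.
have E : (n - k = (n - k.+1).+1)%N by lia.
rewrite subSS E (qpochVS k) (qpochVS (n - k.+1)) qpochS -E.
have -> : q ^+ n.+1 = q ^+ (n - k) * q ^+ k.+1 by rewrite -exprD; congr (_ ^+ _); lia.
ring.
Qed.

Lemma qbin_sub n k : (k <= n)%N -> qbin q n (n - k) = qbin q n k.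
Proof.
by move=> kn; rewrite !qbinE ?leq_subr // subKn // -!mulrA [qpochV _ k * _]mulrC.
Qed.

(** The q-Vandermonde sum with its second factor left free, so that [g] can be either a row of
    q-binomials or its limit 1/(q;q)_k. *)
Definition qconv (m : nat) (g : nat -> F) (k : nat) : F :=
  \sum_(a < k.+1) q ^+ ((m - a) * (k - a)) * qbin q m a * g (k - a)%N.

Lemma qconv0 g k : qconv 0 g k = g k.
Proof.
rewrite /qconv big_ord_recl /= mul1r subn0 mul1r big1 ?addr0 // => i _.
by rewrite mulr0 mul0r.
Qed.

(** In the sum for [g'], the part q^(p+1) g(p+1) raises the exponent (m-a)(k-a) to (m+1-a)(k-a), and
    the part g(p), reindexed by a -> a+1, supplies the second term of the recursion of
    [qbin q m.+1]. *)
Lemma qconvS m g g' k : g' 0%N = g 0%N ->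
    (forall p, g' p.+1 = q ^+ p.+1 * g p.+1 + g p) ->
  qconv m.+1 g k = qconv m g' k.
Proof.
move=> g'0 g'S.
have -> : qconv m g' k =
    \sum_(a < k.+1) q ^+ ((m.+1 - a) * (k - a)) * qbin q m a * g (k - a)%N
  + \sum_(a < k) q ^+ ((m - a) * (k - a)) * qbin q m a * g (k - a.+1)%N.
  rewrite /qconv !big_ord_recr /= !subnn !muln0 g'0 [RHS]addrAC -big_split /=.
  congr (_ + _); apply: eq_bigr => -[a /= ak] _.
  have [ma|am] := ltnP m a; first by rewrite qbin_small // !mulr0 !mul0r addr0.
  have -> : (k - a = (k - a.+1).+1)%N by lia.
  by rewrite g'S subSn // mulSn exprD; ring.
rewrite /qconv big_ord_recl [in RHS]big_ord_recl /= !qbinn0 -addrA -big_split.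
congr (_ + _); apply: eq_bigr => -[a /= ak] _.
rewrite /bump /= add1n subSS mulrDr mulrDl; congr (_ + _).
congr (_ * _); rewrite mulrA -exprD; congr (q ^+ _ * _).
have -> : (k - a = (k - a.+1).+1)%N by lia.
by rewrite mulnS addnC.
Qed.

Lemma qbin_vandermonde m n k : qbin q (m + n) k = qconv m (qbin q n) k.
Proof.
elim: m n => [|m IHm] n; first by rewrite qconv0.
rewrite addSnnS IHm; apply/esym/qconvS => [|p]; first by rewrite !qbinn0.
exact: qbinSr.
Qed.

(** The sequence [qpochV q] satisfies the rule of [qconvS] with [g' = g], so raising [m] leaves the
    sum unchanged. *)
Lemma qpochV_vandermonde m k : qpochV q k = qconv m (qpochV q) k.
Proof.
elim: m => [|m ->]; first by rewrite qconv0.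
by apply/esym/qconvS => // p; rewrite (qpochVS p); ring.
Qed.

End QBinomials.

(** * Reindexing of bounded sums *)

Lemma sum_ord_shift (V : nmodType) (N a : nat) (h : nat -> V) :
  \sum_(r < N | (a <= r)%N) h r = \sum_(n < N | (n + a < N)%N) h (n + a)%N.
Proof.
rewrite -(big_mkord (fun r => a <= r)%N).
rewrite -(big_mkord (fun n => n + a < N)%N (fun n => h (n + a)%N)).
rewrite -(big_nat_widenl _ 0 _ predT) // -[X in index_iota X _](add0n a) big_addn.
rewrite (big_nat_widen 0 (N - a) N) ?leq_subr //.
by apply: eq_bigl => i /=; rewrite ltn_subRL addnC.
Qed.

(** Substitutes r = n + a, s = p + a when [f] is a sum over a common shift [a]. The second
    hypothesis lets [n] and [p] range over all of ['I_N]: the terms added beyond the bound are 0. *)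
Lemma sum2_unshift (R : pzRingType) (N : nat) (H f : nat -> nat -> R)
    (g : nat -> nat -> nat -> R) :
    (forall r s, (r < N)%N -> (s < N)%N ->
       f r s = \sum_(a < N | (a <= r)%N && (a <= s)%N) g a (r - a)%N (s - a)%N) ->
    (forall a n p, ~~ ((n + a < N)%N && (p + a < N)%N) ->
       H (n + a)%N (p + a)%N * g a n p = 0) ->
  \sum_(r < N) \sum_(s < N) H r s * f r s =
  \sum_(a < N) \sum_(n < N) \sum_(p < N) H (n + a)%N (p + a)%N * g a n p.
Proof.
move=> fE Hg0.
transitivity (\sum_(a < N) \sum_(r < N | (a <= r)%N) \sum_(s < N | (a <= s)%N)
    H r s * g a (r - a)%N (s - a)%N).
  under eq_bigr => r _.
    under eq_bigr => s _ do rewrite fE // mulr_sumr big_mkcondr /=.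
    rewrite exchange_big big_mkcond /=; over.
  rewrite exchange_big /=; apply: eq_bigr => a _.
  rewrite [RHS]big_mkcond; apply: eq_bigr => r _; case: ifP => // _.
  by rewrite [RHS]big_mkcond; apply: eq_bigr => s _; case: ifP.
apply: eq_bigr => a _.
rewrite (sum_ord_shift N a (fun r => \sum_(s < N | (a <= s)%N)
  H r s * g a (r - a)%N (s - a)%N)) big_mkcond /=.
apply: eq_bigr => n _.
rewrite (sum_ord_shift N a (fun s => H (n + a)%N s *
  g a (n + a - a)%N (s - a)%N)) big_mkcond /= addnK.
case: ifP => Hn; last by rewrite big1 // => p _; rewrite Hg0 // Hn.
apply: eq_bigr => p _; rewrite addnK.
by case: ifP => Hp //; rewrite Hg0 // Hn Hp.
Qed.

(* [1 / (q; q)_(L - x)], vanishing when [L < x]. *)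
Definition qpochVsub (F : fieldType) (q : F) (L x : nat) : F :=
  if (x <= L)%N then qpochV q (L - x) else 0.

(** * Expansion of products of q-binomials into a fourfold sum *)

Section Expansion.
Variables (F : fieldType) (q : F).
Hypothesis qN1 : forall k : nat, (0 < k)%N -> q ^+ k <> 1.

Lemma qpochVsub_large L x : (L < x)%N -> qpochVsub q L x = 0.
Proof. by move=> Lx; rewrite /qpochVsub leqNgt Lx. Qed.

(** Vandermonde for 1/(q;q)_p with the free parameter chosen as [n]: the numerator (q;q)_n of each
    [n, d] cancels the factor 1/(q;q)_n. *)
Lemma qpochVM_expand N n p : (n < N)%N -> (p < N)%N ->
  qpochV q n * qpochV q p =
  \sum_(d < N | (d <= n)%N && (d <= p)%N)
    q ^+ ((n - d) * (p - d)) * qpochV q d * qpochV q (n - d) * qpochV q (p - d).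
Proof.
move=> nN pN; rewrite (qpochV_vandermonde qN1 n p) /qconv mulr_sumr.
rewrite (big_ord_widen_cond N xpredT (fun a => qpochV q n *
  (q ^+ ((n - a) * (p - a)) * qbin q n a * qpochV q (p - a)))) //=.
rewrite [RHS](eq_bigl (fun d : 'I_N => (d <= p)%N && (d <= n)%N)); last first.
  by move=> i; rewrite andbC.
rewrite [RHS]big_mkcondr /=; apply: eq_bigr => -[d /= dN] dp.
have [dn|nd] := leqP d n; last by rewrite qbin_small // !(mulr0, mul0r).
rewrite qbinE //; transitivity (qpoch q q n * qpochV q n
    * (q ^+ ((n - d) * (p - d)) * qpochV q d * qpochV q (n - d) * qpochV q (p - d))).
  by ring.
by rewrite qpochK // mul1r.
Qed.

(** Vandermonde for [L, s] along L = r + (L - r); the numerators (q;q)_r and (q;q)_(L-r) it produces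
    cancel the denominators of [L, r]. *)
Lemma qbinM_expand N L r s : (r < N)%N -> (s < N)%N ->
  qbin q L r * qbin q L s =
  \sum_(a < N | (a <= r)%N && (a <= s)%N)
    q ^+ ((r - a) * (s - a)) * (qpoch q q L
      * qpochVsub q L (r - a + (s - a) + a) * qpochV q a
      * qpochV q (r - a) * qpochV q (s - a)).
Proof.
move=> rN sN; have [Lr|rL] := ltnP L r.
  rewrite (qbin_small q Lr) mul0r big1 // => -[a /= _] /andP[ar as_].
  by rewrite qpochVsub_large ?(mulr0, mul0r) //; lia.
have E : L = (r + (L - r))%N by lia.
have -> : qbin q L s = qconv q r (qbin q (L - r)) s by rewrite {1}E qbin_vandermonde.
rewrite /qconv mulr_sumr.
rewrite (big_ord_widen_cond N xpredT (fun a => qbin q L r *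
  (q ^+ ((r - a) * (s - a)) * qbin q r a * qbin q (L - r) (s - a)))) //=.
rewrite [RHS](eq_bigl (fun d : 'I_N => (d <= s)%N && (d <= r)%N)); last first.
  by move=> i; rewrite andbC.
rewrite [RHS]big_mkcondr /=; apply: eq_bigr => -[a /= aN]; rewrite ltnS => as_.
have [ar|ra] := leqP a r; last by rewrite (qbin_small q ra) !(mulr0, mul0r).
rewrite (qbinE qN1 ar) (qbinE qN1 rL).
have [h|h] := leqP (s - a) (L - r); last first.
  by rewrite (qbin_small q h) qpochVsub_large ?(mulr0, mul0r) //; lia.
rewrite (qbinE qN1 h) /qpochVsub ifT; last by lia.
have -> : (L - (r - a + (s - a) + a) = L - r - (s - a))%N by lia.
set X := qpochV q (_ - _ - _).
transitivity ((qpoch q q r * qpochV q r) * (qpoch q q (L - r) * qpochV q (L - r)) *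
 (q ^+ ((r - a) * (s - a)) *
(qpoch q q L * X * qpochV q a * qpochV q (r - a) *
 qpochV q (s - a)))).
  by ring.
by rewrite !qpochK // !mul1r.
Qed.

Lemma sum_qbinM_expand N L (K : nat -> nat -> F) : (L < N)%N ->
  \sum_(r < N) \sum_(s < N) K r s * (qbin q L r * qbin q L s) =
  \sum_(a < N) \sum_(d < N) \sum_(c < N) \sum_(b < N)
    K (c + d + a)%N (b + d + a)%N * q ^+ ((c + d) * (b + d) + c * b)
    * (qpoch q q L * qpochVsub q L (a + b + c + 2 * d)
       * qpochV q a * qpochV q b * qpochV q c * qpochV q d).
Proof.
move=> LN.
rewrite (@sum2_unshift _ N K (fun r s => qbin q L r * qbin q L s)
  (fun a n p => q ^+ (n * p) * (qpoch q q L
      * qpochVsub q L (n + p + a) * qpochV q a * qpochV q n * qpochV q p))).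
- apply: eq_bigr => a _.
  (* [H] keeps everything except 1/((q;q)_n (q;q)_p), which is then expanded with the second shift
     [d]: n = c + d and p = b + d. *)
  pose H n p := K (n + a)%N (p + a)%N * q ^+ (n * p) * (qpoch q q L
      * qpochVsub q L (n + p + a) * qpochV q a).
  transitivity (\sum_(n < N) \sum_(p < N) H n p * (qpochV q n * qpochV q p)).
    by apply: eq_bigr => n _; apply: eq_bigr => p _; rewrite /H; ring.
  rewrite (@sum2_unshift _ N H (fun n p => qpochV q n * qpochV q p)
    (fun d c b => q ^+ (c * b) * qpochV q d * qpochV q c * qpochV q b)).
  + apply: eq_bigr => d _; apply: eq_bigr => c _; apply: eq_bigr => b _.
    rewrite /H exprD.
    have -> : (c + d + (b + d) + a = a + b + c + 2 * d)%N by lia.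
    by ring.
  + by move=> r s rN sN; rewrite (qpochVM_expand rN sN).
  move=> d c b h; rewrite /H qpochVsub_large ?(mulr0, mul0r) //; lia.
- by move=> r s rN sN; rewrite (qbinM_expand L rN sN).
move=> a n p h; rewrite qpochVsub_large ?(mulr0, mul0r) //; lia.
Qed.

End Expansion.

(** * Coefficients of a product of three Euler series *)

Section TripleSum.
Variables (F : fieldType) (q : F).
Hypothesis qN1 : forall k : nat, (0 < k)%N -> q ^+ k <> 1.

(** Euler's coefficient of x^a in (-x;q)_oo. *)
Definition qexp (a : nat) : F := q ^+ 'C(a, 2) * qpochV q a.

Lemma qexpS a : qexp a.+1 = q ^+ a.+1 * qexp a.+1 + q ^+ a * qexp a.
Proof. by rewrite /qexp (qpochVS qN1 a) binS bin1 exprD; ring. Qed.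

(* Coefficientwise form of the functional equation E(x) = (1 + x) E(q x)
   satisfied by E(x) = \sum_a qexp a x^a. *)
Lemma sum_qexp N (h : nat -> F) : h N = 0 ->
  \sum_(a < N) qexp a * h a = \sum_(a < N) q ^+ a * qexp a * (h a + h a.+1).
Proof.
case: N => [|N] hN; first by rewrite !big_ord0.
(* Truncating the series after [n] leaves one boundary term, a multiple of [h n.+1]; at the full
   bound it is killed by [hN]. *)
suff E n : \sum_(a < n.+1) qexp a * h a + q ^+ n * qexp n * h n.+1 =
    \sum_(a < n.+1) q ^+ a * qexp a * (h a + h a.+1).
  by rewrite -E hN mulr0 addr0.
elim: n => [|n IHn]; first by rewrite !big_ord_recr !big_ord0 /= expr0; ring.
by rewrite big_ord_recr [RHS]big_ord_recr /= -IHn {1}qexpS; ring.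
Qed.

Definition qexp3 (N : nat) (h : nat -> nat -> nat -> F) : F :=
  \sum_(a < N) \sum_(b < N) \sum_(c < N) qexp a * qexp b * qexp c * h a b c.

Lemma eq_qexp3 N h h' : (forall a b c, h a b c = h' a b c) ->
  qexp3 N h = qexp3 N h'.
Proof.
move=> E; apply: eq_bigr => a _; apply: eq_bigr => b _; apply: eq_bigr => c _.
by rewrite E.
Qed.

Lemma qexp3D N h h' :
  qexp3 N (fun a b c => h a b c + h' a b c) = qexp3 N h + qexp3 N h'.
Proof.
rewrite /qexp3 -big_split; apply: eq_bigr => a _; rewrite -big_split.
apply: eq_bigr => b _; rewrite -big_split; apply: eq_bigr => c _.
exact: mulrDr.
Qed.

Lemma qexp3Z N x h :
  qexp3 N (fun a b c => x * h a b c) = x * qexp3 N h.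
Proof.
rewrite /qexp3 mulr_sumr; apply: eq_bigr => a _; rewrite mulr_sumr.
apply: eq_bigr => b _; rewrite mulr_sumr; apply: eq_bigr => c _.
exact: mulrCA.
Qed.

Lemma qexp3_eq0 N h : (forall a b c, h a b c = 0) -> qexp3 N h = 0.
Proof.
move=> h0; rewrite /qexp3 big1 // => a _; rewrite big1 // => b _.
by rewrite big1 // => c _; rewrite h0 mulr0.
Qed.

(** The functional equation of the first Euler factor, the others being held fixed; the swaps below
    carry it to the other two factors. *)
Lemma qexp3_step1 N h : (forall b c, h N b c = 0) ->
  qexp3 N h = qexp3 N (fun a b c => q ^+ a * (h a b c + h a.+1 b c)).
Proof.
move=> h0.
have E h' : qexp3 N h' =
    \sum_(a < N) qexp a * \sum_(b < N) \sum_(c < N) qexp b * qexp c * h' a b c.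
  apply: eq_bigr => a _; rewrite mulr_sumr; apply: eq_bigr => b _.
  by rewrite mulr_sumr; apply: eq_bigr => c _; ring.
rewrite !E (sum_qexp (h := fun a =>
  \sum_(b < N) \sum_(c < N) qexp b * qexp c * h a b c)); last first.
  by rewrite big1 // => b _; rewrite big1 // => c _; rewrite h0 mulr0.
apply: eq_bigr => a _; rewrite -big_split /= -mulrA mulrCA mulr_sumr.
congr (_ * _); apply: eq_bigr => b _; rewrite -big_split mulr_sumr.
by apply: eq_bigr => c _ /=; ring.
Qed.

Lemma qexp3_swap12 N h : qexp3 N h = qexp3 N (fun a b c => h b a c).
Proof.
rewrite /qexp3 exchange_big; apply: eq_bigr => a _; apply: eq_bigr => b _.
by apply: eq_bigr => c _; rewrite (mulrC (qexp b)).
Qed.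

Lemma qexp3_swap13 N h : qexp3 N h = qexp3 N (fun a b c => h c b a).
Proof.
rewrite /qexp3; under eq_bigr => a _ do rewrite exchange_big.
rewrite exchange_big; apply: eq_bigr => a _; rewrite exchange_big.
apply: eq_bigr => b _; apply: eq_bigr => c _; ring.
Qed.

Lemma qexp3_step2 N h : (forall a c, h a N c = 0) ->
  qexp3 N h = qexp3 N (fun a b c => q ^+ b * (h a b c + h a b.+1 c)).
Proof.
move=> h0; by rewrite qexp3_swap12 qexp3_step1 // [RHS]qexp3_swap12.
Qed.

Lemma qexp3_step3 N h : (forall a b, h a b N = 0) ->
  qexp3 N h = qexp3 N (fun a b c => q ^+ c * (h a b c + h a b c.+1)).
Proof.
move=> h0; by rewrite qexp3_swap13 qexp3_step1 // [RHS]qexp3_swap13.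
Qed.

(** Inside [qexp3] this extracts the coefficient of x^k from E(x) E(zx) E(x/z), with [w (b - c)] in
    place of z^(b-c). *)
Definition layer (w : int -> F) (k a b c : nat) : F :=
  w (b%:Z - c%:Z) *+ (a + b + c == k)%N.

(** Replacing x by qx multiplies the coefficient of x^k by q^k. *)
Lemma mulr_expn_layer w k a b c :
  q ^+ (a + b + c) * layer w k a b c = q ^+ k * layer w k a b c.
Proof. by rewrite /layer; case: eqP => [->|] //; rewrite !mulr0. Qed.

Section ZeroSum.
Variable w : int -> F.
Hypothesis w_sum0 : forall j, w (j - 1) + w j + w (j + 1) = 0.

(** This and [layer_sum2] say that the coefficients of x and x^2 in (1 + x)(1 + zx)(1 + x/z) = 1 +
    x^3 vanish: the three index shifts move b - c by 0, 1 and -1 in some order. *)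
Lemma layer_sum1 k a b c :
  layer w k a.+1 b c + layer w k a b.+1 c + layer w k a b c.+1 = 0.
Proof.
rewrite /layer !(addSn, addnS); case: eqP => _; rewrite ?mulr1n ?mulr0n ?addr0 //.
rewrite -[RHS](w_sum0 (b%:Z - c%:Z)).
have -> : b.+1%:Z - c%:Z = b%:Z - c%:Z + 1 by lia.
have -> : b%:Z - c.+1%:Z = b%:Z - c%:Z - 1 by lia.
by ring.
Qed.

Lemma layer_sum2 k a b c :
  layer w k a.+1 b.+1 c + layer w k a.+1 b c.+1 + layer w k a b.+1 c.+1 = 0.
Proof.
rewrite /layer !(addSn, addnS); case: eqP => _; rewrite ?mulr1n ?mulr0n ?addr0 //.
rewrite -[RHS](w_sum0 (b%:Z - c%:Z)).
have -> : b.+1%:Z - c%:Z = b%:Z - c%:Z + 1 by lia.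
have -> : b%:Z - c.+1%:Z = b%:Z - c%:Z - 1 by lia.
have -> : b.+1%:Z - c.+1%:Z = b%:Z - c%:Z by lia.
by ring.
Qed.

(* With weights z^(b - c), z a primitive cube root of unity, this is
   E(x) E(zx) E(x/z) = (1 + x^3) E(qx) E(zqx) E(qx/z); only the vanishing of
   the sum of three consecutive weights is needed. *)
Lemma qexp3_layer_rec N k : (k < N)%N ->
  (1 - q ^+ k) * qexp3 N (layer w k) =
  qexp3 N (fun a b c => q ^+ (a + b + c) * layer w k a.+1 b.+1 c.+1).
Proof.
move=> kN; apply/eqP; rewrite mulrBl mul1r subr_eq addrC; apply/eqP.
have l0 a b c : (k < a + b + c)%N -> layer w k a b c = 0.
  by move=> h; rewrite /layer gtn_eqF.
rewrite -qexp3Z -qexp3D.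
rewrite qexp3_step1; last by move=> b c; rewrite l0 //; lia.
rewrite qexp3_step2; last first.
  by move=> a c; rewrite !l0 ?addr0 ?mulr0 //; lia.
rewrite qexp3_step3; last first.
  by move=> a b; rewrite !l0 ?addr0 ?mulr0 ?addr0 ?mulr0 //; lia.
apply: eq_qexp3 => a b c; rewrite -mulr_expn_layer !exprD.
set x := q ^+ a; set y := q ^+ b; set z := q ^+ c.
(* The eight terms of (1 + x)(1 + zx)(1 + x/z), grouped by degree: 0 and 3 together, then 1, then
   2. *)
transitivity (x * y * z * ((layer w k a b c + layer w k a.+1 b.+1 c.+1) +
  (layer w k a.+1 b c + layer w k a b.+1 c + layer w k a b c.+1) +
  (layer w k a.+1 b.+1 c + layer w k a.+1 b c.+1 + layer w k a b.+1 c.+1))).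
  by ring.
by rewrite layer_sum1 layer_sum2 !addr0 mulrDr.
Qed.

Lemma qexp3_layer0 N : (0 < N)%N -> qexp3 N (layer w 0) = w 0.
Proof.
case: N => // N _; rewrite /qexp3.
have l0 a b c : (0 < a + b + c)%N -> layer w 0 a b c = 0.
  by move=> h; rewrite /layer gtn_eqF.
rewrite big_ord_recl [X in _ + X]big1 => [|a _]; last first.
  by rewrite big1 // => b _; rewrite big1 // => c _; rewrite l0 ?mulr0.
rewrite addr0 big_ord_recl [X in _ + X]big1 => [|b _]; last first.
  by rewrite big1 // => c _; rewrite l0 ?mulr0.
rewrite addr0 big_ord_recl [X in _ + X]big1 => [|c _]; last by rewrite l0 ?mulr0.
by rewrite /layer /qexp /= qpochV0 subrr !expr0 !mulr1 !addr0 mul1r mulr1n.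
Qed.

Lemma layer_shift k a b c : layer w k.+3 a.+1 b.+1 c.+1 = layer w k a b c.
Proof.
rewrite /layer !addSn !addnS; congr (w _ *+ _); lia.
Qed.

Lemma qexp3_layerS3 N k : (k.+3 < N)%N ->
  (1 - q ^+ k.+3) * qexp3 N (layer w k.+3) = q ^+ k * qexp3 N (layer w k).
Proof.
move=> kN; rewrite qexp3_layer_rec // -qexp3Z; apply: eq_qexp3 => a b c.
by rewrite layer_shift mulr_expn_layer.
Qed.

(** Raising all three indices makes the total degree at least 3 > k, so the right side of the
    recurrence is 0, while 1 - q^k is invertible. *)
Lemma qexp3_layer_12 N k : (0 < k < 3)%N -> (k < N)%N ->
  qexp3 N (layer w k) = 0.
Proof.
move=> /andP[k0 k3] kN; apply: (mulfI (subr1_expS_neq0 qN1 k.-1)).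
rewrite mulr0 prednK // qexp3_layer_rec // qexp3_eq0 // => a b c.
by rewrite /layer gtn_eqF ?mulr0n ?mulr0 //; lia.
Qed.

Lemma q3_not_root1 k : (0 < k)%N -> (q ^+ 3) ^+ k <> 1.
Proof. by move=> k0; rewrite -exprM; apply: qN1; rewrite muln_gt0. Qed.

(** Iterating the three-step recurrence from [w 0] gives the Euler coefficients of (-x^3;q^3)_oo,
    the base being q^3. *)
Lemma qexp3_layer_mul3 N n : (3 * n < N)%N ->
  qexp3 N (layer w (3 * n)) =
  w 0 * (q ^+ (3 * 'C(n, 2)) * qpochV (q ^+ 3) n).
Proof.
elim: n => [|n IHn] nN.
  by rewrite muln0 qexp3_layer0 ?bin_small ?expr0 ?qpochV0 ?mulr1 //; lia.
have E : (3 * n.+1 = (3 * n).+3)%N by lia.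
rewrite E; apply: (mulfI (subr1_expS_neq0 qN1 (3 * n).+2)).
rewrite qexp3_layerS3 -?E // IHn; last lia.
rewrite (qpochVS q3_not_root1 n) binS bin1 mulnDr exprD -exprM; ring.
Qed.

Lemma qexp3_layer_mul3D N n i : (0 < i < 3)%N -> (3 * n + i < N)%N ->
  qexp3 N (layer w (3 * n + i)) = 0.
Proof.
move=> i3; elim: n => [|n IHn] nN.
  by rewrite muln0 add0n qexp3_layer_12.
have E : (3 * n.+1 + i = (3 * n + i).+3)%N by lia.
rewrite E; apply: (mulfI (subr1_expS_neq0 qN1 (3 * n + i).+2)).
rewrite qexp3_layerS3 -?E // IHn; last lia.
by rewrite !mulr0.
Qed.

End ZeroSum.

(** The functional equation is applied to the third factor only, the one whose argument lacks q. Its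
    1 + x/z gives two terms; the x/z term lowers the degree by 1 and shifts the weight by -1. *)
Lemma qexp3_layer_pow N w k : (k < N)%N ->
  qexp3 N (fun a b c => q ^+ (a + b) * layer w k a b c) =
  q ^+ k * qexp3 N (layer w k) +
  (if k is k'.+1 then
     q ^+ k' * qexp3 N (layer (fun j => w (j - 1)) k') else 0).
Proof.
move=> kN; rewrite qexp3_step3; last first.
  by move=> a b; rewrite /layer gtn_eqF ?mulr0 //; lia.
transitivity (qexp3 N (fun a b c => q ^+ k * layer w k a b c) +
  qexp3 N (fun a b c => q ^+ (a + b + c) * layer w k a b c.+1)).
  rewrite -qexp3D; apply: eq_qexp3 => a b c.
  by rewrite -mulr_expn_layer !exprD; ring.
rewrite qexp3Z; congr (_ + _); case: k kN => [|k] kN.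
  by rewrite qexp3_eq0 // => a b c; rewrite /layer addnS mulr0.
rewrite -qexp3Z; apply: eq_qexp3 => a b c; rewrite -mulr_expn_layer.
by rewrite /layer addnS eqSS; congr (_ * (w _ *+ _)); lia.
Qed.

End TripleSum.

(** * Selecting terms of sums, and arithmetic of the exponents *)

Lemma sum_ord_pick (R : pzRingType) (N n : nat) (f : nat -> R) (x : R) :
  \sum_(k < N) f k * (x *+ (n == k)%N) = if (n < N)%N then f n * x else 0.
Proof.
have [nN|Nn] := ltnP n N; last first.
  by rewrite big1 // => k _; rewrite gtn_eqF ?mulr0 // (leq_trans _ Nn).
rewrite (bigD1 (Ordinal nN)) //= eqxx big1 ?addr0 // => k kn.
rewrite (_ : (n == k) = false) ?mulr0 //.
by apply/negbTE; apply: contraNneq kn => nk; apply/eqP/val_inj.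
Qed.

Lemma sum_ord_mul3 (V : nmodType) (M : nat) (f : nat -> V) :
  \sum_(k < 3 * M) f k =
  \sum_(n < M) (f (3 * n)%N + f (3 * n + 1)%N + f (3 * n + 2)%N).
Proof.
elim: M => [|M IHM]; first by rewrite !big_ord0.
rewrite [RHS]big_ord_recr /= -IHM (_ : (3 * M.+1 = (3 * M).+3)%N); last by lia.
by rewrite !big_ord_recr /= !addn1 !addn2 !addrA.
Qed.

Lemma bin2D n : (2 * 'C(n, 2) + n = n * n)%N.
Proof. by elim: n => // n IHn; rewrite binS bin1; lia. Qed.

(* r^2 + s^2 - r s: one of the two truncated differences is always 0. *)
Definition qform (r s : nat) : nat := (s - r) ^ 2 + (r - s) ^ 2 + r * s.

(** The left side collects the quadratic form and the exponents of both Vandermonde expansions. On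
    the right, apart from the three binomials belonging to [qexp], only a + b + c and d occur, so
    the sum over a, b, c becomes a [qexp3]. *)
Lemma qform_shift a b c d :
  (qform (c + d + a) (b + d + a) + ((c + d) * (b + d) + c * b) =
   'C((a + b + c).+1, 2) + 2 * d * (a + b + c) + 2 * d ^ 2
   + ('C(a, 2) + 'C(b, 2) + 'C(c, 2)))%N.
Proof.
have := bin2D (a + b + c).+1; have := bin2D a; have := bin2D b; have := bin2D c.
rewrite /qform !subnDr; move: 'C(_, _) 'C(_, _) 'C(_, _) 'C(_, _) => u v x y.
have [cb|/ltnW bc] := leqP c b.
  rewrite (eqP cb); have [e ->] : exists e, b = (c + e)%N by exists (b - c)%N; lia.
  rewrite addKn; lia.
rewrite (eqP bc); have [e ->] : exists e, c = (b + e)%N by exists (c - b)%N; lia.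
rewrite addKn; lia.
Qed.

(** * Collapse to the double sum over m and n *)

Section Collapse.
Variables (F : fieldType) (q : F).
Hypothesis qN1 : forall k : nat, (0 < k)%N -> q ^+ k <> 1.

(** The parameter [t] is 0 for the first identity and 1 for the second. Since s = a + b + d, the
    factor q^(ts) splits into q^(td) and a factor q^(t(a+b)) inside the triple sum. *)
Lemma sum_qform_layers N L t (w : int -> F) : (L < N)%N ->
  \sum_(r < N) \sum_(s < N) w (s%:Z - r%:Z) * q ^+ (qform r s + t * s)
    * (qbin q L r * qbin q L s) =
  \sum_(d < N) \sum_(k < N)
    q ^+ ('C(k.+1, 2) + 2 * d * k + 2 * d ^ 2 + t * d)
    * (qpoch q q L * qpochVsub q L (k + 2 * d) * qpochV q d)
    * qexp3 q N (fun a b c => q ^+ (t * (a + b)) * layer w k a b c).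
Proof.
move=> LN; rewrite (sum_qbinM_expand qN1 (fun r s : nat =>
  w (s%:Z - r%:Z) * q ^+ (qform r s + t * s)) LN) exchange_big.
apply: eq_bigr => d _.
transitivity (\sum_(a < N) \sum_(b < N) \sum_(c < N) \sum_(k < N)
    q ^+ ('C(k.+1, 2) + 2 * d * k + 2 * d ^ 2 + t * d)
    * (qpoch q q L * qpochVsub q L (k + 2 * d) * qpochV q d)
    * (qexp q a * qexp q b * qexp q c
       * (q ^+ (t * (a + b)) * layer w k a b c))); last first.
  under [RHS]eq_bigr => k _.
    rewrite /qexp3 mulr_sumr.
    under eq_bigr => a _.
      rewrite mulr_sumr; under eq_bigr => b _ do rewrite mulr_sumr.
      over.
    over.
  rewrite [RHS]exchange_big; apply: eq_bigr => a _.
  rewrite [RHS]exchange_big; apply: eq_bigr => b _.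
  by rewrite [RHS]exchange_big.
apply: eq_bigr => a _; rewrite exchange_big; apply: eq_bigr => b _.
apply: eq_bigr => c _.
pose f k := q ^+ ('C(k.+1, 2) + 2 * d * k + 2 * d ^ 2 + t * d)
  * (qpoch q q L * qpochVsub q L (k + 2 * d) * qpochV q d)
  * (qexp q a * qexp q b * qexp q c) * q ^+ (t * (a + b)).
rewrite [RHS](eq_bigr (fun k : 'I_N =>
  f k * (w (b%:Z - c%:Z) *+ (a + b + c == k)%N))); last first.
  by move=> k _; rewrite /f /layer !mulrA.
rewrite sum_ord_pick /f.
(* When a + b + c is at least [N] no [k] is selected; the other side is 0 too, because then a + b +
   c > L. *)
case: ltnP => h; last by rewrite qpochVsub_large ?(mulr0, mul0r) //; lia.
have -> : (b + d + a)%:Z - (c + d + a)%:Z = b%:Z - c%:Z by lia.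
rewrite /qexp; set X := qpochVsub _ _ _; set W := w _.
transitivity (q ^+ (qform (c + d + a) (b + d + a) + ((c + d) * (b + d) + c * b))
  * q ^+ (t * (b + d + a)) * W
  * (qpoch q q L * X * qpochV q a * qpochV q b * qpochV q c * qpochV q d)).
  by rewrite !exprD; ring.
rewrite qform_shift !exprD (_ : (t * (b + d + a) = t * d + t * (a + b))%N); last by lia.
by rewrite exprD; ring.
Qed.

(** The bound [N] is a multiple of 3, so k splits evenly into the classes 3n, 3n + 1, 3n + 2 with n
    < L + 1, and only the first class survives. *)
Lemma sum_qform_collapse0 L (w : int -> F) (N := (3 * L.+1)%N) :
    (forall j, w (j - 1) + w j + w (j + 1) = 0) -> w 0 = 1 ->
  \sum_(r < N) \sum_(s < N) w (s%:Z - r%:Z) * q ^+ qform r s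
    * (qbin q L r * qbin q L s) =
  \sum_(m < N) \sum_(n < L.+1)
    q ^+ (2 * m ^ 2 + 6 * m * n + 6 * n ^ 2) * qpoch q q L
    * qpochVsub q L (3 * n + 2 * m) * qpochV q m * qpochV (q ^+ 3) n.
Proof.
move=> wS w0; have LN : (L < N)%N by rewrite /N; lia.
have := sum_qform_layers 0 w LN.
under eq_bigr => r _ do under eq_bigr => s _ do rewrite mul0n addn0.
move=> ->; apply: eq_bigr => m _.
pose f k := q ^+ ('C(k.+1, 2) + 2 * m * k + 2 * m ^ 2 + 0 * m)
  * (qpoch q q L * qpochVsub q L (k + 2 * m) * qpochV q m)
  * qexp3 q N (layer w k).
rewrite (eq_bigr (fun k : 'I_N => f k)) => [|k _]; last first.
  by congr (_ * _); apply: eq_qexp3 => a b c; rewrite mul0n mul1r.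
rewrite sum_ord_mul3 {}/f.
apply: eq_bigr => -[n /= nL] _.
rewrite !(@qexp3_layer_mul3D _ _ qN1 _ wS) ?mulr0 ?addr0 //; try by rewrite /N; lia.
rewrite (@qexp3_layer_mul3 _ _ qN1 _ wS) ?w0 ?mul1r; last by rewrite /N; lia.
transitivity (q ^+ ('C((3 * n).+1, 2) + 2 * m * (3 * n) + 2 * m ^ 2 + 0 * m
      + 3 * 'C(n, 2)) * (qpoch q q L
    * qpochVsub q L (3 * n + 2 * m) * qpochV q m * qpochV (q ^+ 3) n)).
  by rewrite [in RHS]exprD; ring.
(* The exponents agree because C(3n+1, 2) + 3 C(n, 2) = 6n^2. *)
rewrite -!mulrA; congr (q ^+ _ * _).
by have := bin2D (3 * n).+1; have := bin2D n; lia.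
Qed.

(** By [qexp3_layer_pow], k = 3n contributes through [w] and k = 3n + 1 through the shifted weight,
    whose value at 0 is [w (-1)]; these are the two double sums, and k = 3n + 2 contributes
    nothing. *)
Lemma sum_qform_collapse1 L (w : int -> F) (N := (3 * L.+1)%N) :
    (forall j, w (j - 1) + w j + w (j + 1) = 0) -> w 0 = 1 -> w (-1) = 1 ->
  \sum_(r < N) \sum_(s < N) w (s%:Z - r%:Z) * q ^+ (qform r s + s)
    * (qbin q L r * qbin q L s) =
  \sum_(m < N) \sum_(n < L.+1)
    q ^+ (2 * m ^ 2 + 6 * m * n + 6 * n ^ 2 + m + 3 * n) * qpoch q q L
    * qpochVsub q L (3 * n + 2 * m) * qpochV q m * qpochV (q ^+ 3) n
  + q * \sum_(m < N) \sum_(n < L.+1)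
    q ^+ (2 * m ^ 2 + 6 * m * n + 6 * n ^ 2 + 3 * m + 6 * n) * qpoch q q L
    * qpochVsub q L (3 * n + 2 * m + 1) * qpochV q m * qpochV (q ^+ 3) n.
Proof.
move=> wS w0 wN1; have LN : (L < N)%N by rewrite /N; lia.
have := sum_qform_layers 1 w LN.
under eq_bigr => r _ do under eq_bigr => s _ do rewrite mul1n.
move=> ->; rewrite mulr_sumr -big_split; apply: eq_bigr => m _.
pose f k := q ^+ ('C(k.+1, 2) + 2 * m * k + 2 * m ^ 2 + 1 * m)
  * (qpoch q q L * qpochVsub q L (k + 2 * m) * qpochV q m)
  * qexp3 q N (fun a b c => q ^+ (a + b) * layer w k a b c).
rewrite (eq_bigr (fun k : 'I_N => f k)) => [|k _]; last first.
  by congr (_ * _); apply: eq_qexp3 => a b c; rewrite mul1n.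
rewrite sum_ord_mul3 {}/f.
rewrite mulr_sumr -big_split; apply: eq_bigr => -[n /= nL] _.
pose w' j := w (j - 1).
have w'S j : w' (j - 1) + w' j + w' (j + 1) = 0.
  by rewrite -[RHS](wS (j - 1)) /w' addrK subrK.
have w'0 : w' 0 = 1 by rewrite /w' sub0r.
rewrite !qexp3_layer_pow //; try by rewrite /N; lia.
rewrite addn1 addn2 -/w' -[in layer w _.+1]addn1 -[in layer w _.+2]addn2.
rewrite -[in layer w' _.+1]addn1.
rewrite !(@qexp3_layer_mul3D _ _ qN1 _ wS) //; try by rewrite /N; lia.
rewrite !(@qexp3_layer_mul3D _ _ qN1 _ w'S) //; try by rewrite /N; lia.
(* For n > 0 the predecessor of 3n is 3(n-1) + 2, where the layer sum vanishes; for n = 0 there is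
   no predecessor. *)
have -> : (if (3 * n)%N is k'.+1 then q ^+ k' * qexp3 q N (layer w' k') else 0) = 0.
  case: n nL => [|n] nL; first by rewrite muln0.
  rewrite (_ : (3 * n.+1 = (3 * n + 2).+1)%N); last by lia.
  by rewrite (@qexp3_layer_mul3D _ _ qN1 _ w'S) ?mulr0 // /N; lia.
rewrite !(@qexp3_layer_mul3 _ _ qN1 _ wS); try by rewrite /N; lia.
rewrite !(@qexp3_layer_mul3 _ _ qN1 _ w'S); try by rewrite /N; lia.
rewrite w0 w'0 !mul1r !mulr0 !addr0 mulr0 addr0 add0r.
have -> : ((3 * n).+1 + 2 * m = 3 * n + 2 * m + 1)%N by lia.
congr (_ + _).
  transitivity (q ^+ ('C((3 * n).+1, 2) + 2 * m * (3 * n) + 2 * m ^ 2 + 1 * m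
      + 3 * n + 3 * 'C(n, 2)) * (qpoch q q L
    * qpochVsub q L (3 * n + 2 * m) * qpochV q m * qpochV (q ^+ 3) n)).
    by rewrite ![in RHS]exprD !exprD; ring.
  rewrite -!mulrA; congr (q ^+ _ * _).
  by have := bin2D (3 * n).+1; have := bin2D n; lia.
transitivity (q ^+ ('C((3 * n).+2, 2) + 2 * m * (3 * n).+1 + 2 * m ^ 2 + 1 * m
      + 3 * n + 3 * 'C(n, 2)) * (qpoch q q L
    * qpochVsub q L (3 * n + 2 * m + 1) * qpochV q m * qpochV (q ^+ 3) n)).
  by rewrite ![in RHS]exprD !exprD; ring.
(* Here C(3n+2, 2) + 3n + 3 C(n, 2) = 6n^2 + 6n + 1, and the 1 is the factor q before the second
   double sum. *)
rewrite -!mulrA [RHS]mulrA -exprS; congr (q ^+ _ * _).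
by have := bin2D (3 * n).+2; have := bin2D n; lia.
Qed.

End Collapse.

(** * Finitely supported sums as bounded sums *)

Lemma fsum_nat2 (V : nmodType) (A B : nat) (f : nat -> nat -> V) :
    (forall m n, ~~ ((m < A)%N && (n < B)%N) -> f m n = 0) ->
  \sum_(p \in [set: nat * nat]) (let: (m, n) := p in f m n) =
  \sum_(m < A) \sum_(n < B) f m n.
Proof.
move=> f0; rewrite -(fsbig_widen (`I_A `*` `I_B)) //; last first.
  by move=> [m n] /= [_ /not_andP h]; apply/f0/negP => /andP[mA nB]; case: h.
under [RHS]eq_bigr => m _ do rewrite (fsbig_ord _ B (f m)).
rewrite (fsbig_ord _ A (fun m => \sum_(n \in `I_B) f m n)).
by rewrite pair_fsbig //; apply: eq_fsbigr => -[].
Qed.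

Lemma fsum_int_itv (V : nmodType) (L : nat) (f : int -> V) :
  \sum_(j \in [set j : int | - L%:Z <= j <= L%:Z]) f j =
  \sum_(k < (2 * L).+1) f (k%:Z - L%:Z).
Proof.
rewrite (fsbig_ord _ (2 * L).+1 (fun k => f (k%:Z - L%:Z))).
apply: reindex_fsbig; split.
- by move=> k /=; lia.
- by move=> k l _ _ /=; lia.
- by move=> j /= jL; exists (absz (j + L%:Z)) => /=; lia.
Qed.

(** * Right-hand sides as sums over the quadratic form *)

Section MainSums.
Variables (F : fieldType) (q : F).
Hypothesis qN1 : forall k : nat, (0 < k)%N -> q ^+ k <> 1.

Lemma qbinomE n k : (k <= n)%N -> qbinom q n%:Z (n%:Z - k%:Z) = qbin q n k.
Proof.
move=> kn; rewrite qbinE // /qbinom.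
have -> : n%:Z - k%:Z = (n - k)%N%:Z by lia.
have -> : n%:Z - (n - k)%N%:Z = k%:Z by lia.
by rewrite /qpochV subnK // invfM mulrA mulrAC.
Qed.

(** Vandermonde with a = L - r: reversing the first index turns the exponent (L - a)s into rs. *)
Lemma sum_qbin_vandermonde N L M (G : nat -> F) : (L + M < N)%N ->
  \sum_(k < N) G k * qbin q (L + M) k =
  \sum_(r < N) \sum_(s < N)
    G (L - r + s)%N * q ^+ (r * s) * (qbin q L r * qbin q M s).
Proof.
move=> LMN.
pose h a s := G (a + s)%N * q ^+ ((L - a) * s) * (qbin q L a * qbin q M s).
have h0 a s : (L < a)%N || (M < s)%N -> h a s = 0.
  by rewrite /h; case/orP => /(qbin_small q) ->; rewrite ?mulr0 ?mul0r ?mulr0.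
transitivity (\sum_(a < N) \sum_(s < N) h a s).
  transitivity (\sum_(k < N) \sum_(a < N | (a <= k)%N) h a (k - a)%N).
    apply: eq_bigr => -[k /= kN] _.
    rewrite qbin_vandermonde // /qconv mulr_sumr.
    rewrite (big_ord_widen_cond N xpredT (fun a => G k *
      (q ^+ ((L - a) * (k - a)) * qbin q L a * qbin q M (k - a)))) //=.
    by apply: eq_bigr => -[a /= aN] ak; rewrite /h subnKC //; ring.
  under eq_bigr => k _ do rewrite big_mkcond.
  rewrite exchange_big; apply: eq_bigr => -[a /= aN] _.
  rewrite -big_mkcond /= (sum_ord_shift N a (fun k => h a (k - a)%N)) big_mkcond.
  apply: eq_bigr => s _ /=; rewrite addnK; case: ltnP => // saN.
  by rewrite h0 //; lia.
(* The reversal a -> L - r is a bijection only on 0..L, so the outer sums are first cut down to that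
   range. *)
have cut (g : nat -> F) : (forall a, (L < a)%N -> g a = 0) ->
    \sum_(a < N) g a = \sum_(a < L.+1) g a.
  move=> g0; rewrite [RHS](big_ord_widen N g); last by lia.
  by rewrite [RHS]big_mkcond; apply: eq_bigr => a _; case: ltnP => // /g0.
rewrite (cut (fun a => \sum_(s < N) h a s)) => [|a La]; last first.
  by rewrite big1 // => s _; rewrite h0 ?La.
rewrite (cut (fun r => \sum_(s < N)
    G (L - r + s)%N * q ^+ (r * s) * (qbin q L r * qbin q M s))) => [|r Lr].
  rewrite (reindex_inj rev_ord_inj); apply: eq_bigr => -[r /= rL] _.
  apply: eq_bigr => s _; rewrite /h subSS qbin_sub // subKn //.
by rewrite big1 // => s _; rewrite (qbin_small q Lr) mul0r mulr0.
Qed.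

Lemma qformZ r s :
  (qform r s)%:Z = (s%:Z - r%:Z) ^+ 2 + r%:Z * s%:Z.
Proof.
rewrite /qform; have [rs|/ltnW sr] := leqP r s.
  have [x ->] : exists x, s = (r + x)%N by exists (s - r)%N; lia.
  rewrite addKn (_ : (r - (r + x) = 0)%N); lia.
have [x ->] : exists x, r = (s + x)%N by exists (r - s)%N; lia.
rewrite addKn (_ : (s - (s + x) = 0)%N); lia.
Qed.

Lemma qformC r s : qform r s = qform s r.
Proof. by rewrite /qform mulnC [in LHS](addnC (expn _ _)). Qed.

(** Since [q] may be 0, integer powers are combined only for nonnegative exponents. *)
Lemma exprz_mulX (x : int) n m :
  0 <= x -> x + n%:Z = m%:Z -> q ^ x * q ^+ n = q ^+ m.
Proof.
case: x => // x _ E; have -> : m = (x + n)%N by lia.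
by rewrite exprD.
Qed.

Lemma mulz_succ_ge0 (j : int) : 0 <= j * (j + 1).
Proof. by nia. Qed.

Lemma sum_qform_swap N L (u : nat -> nat -> F) :
  \sum_(r < N) \sum_(s < N) u r s * (qbin q L r * qbin q L s) =
  \sum_(r < N) \sum_(s < N) u s r * (qbin q L r * qbin q L s).
Proof.
rewrite exchange_big; apply: eq_bigr => r _; apply: eq_bigr => s _.
by rewrite (mulrC (qbin _ _ _)).
Qed.

Lemma sum_sq_qbin N L (w : int -> F) : (2 * L < N)%N ->
  \sum_(k < N) w (k%:Z - L%:Z) * q ^ ((k%:Z - L%:Z) ^+ 2) * qbin q (2 * L) k =
  \sum_(r < N) \sum_(s < N) w (s%:Z - r%:Z) * q ^+ qform r s
    * (qbin q L r * qbin q L s).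
Proof.
move=> LN; rewrite mul2n -addnn (sum_qbin_vandermonde (fun k : nat =>
  w (k%:Z - L%:Z) * q ^ ((k%:Z - L%:Z) ^+ 2))); last by lia.
apply: eq_bigr => r _; apply: eq_bigr => s _.
have [Lr|rL] := ltnP L r; first by rewrite (qbin_small q Lr) mul0r !mulr0.
have -> : (L - r + s)%N%:Z - L%:Z = s%:Z - r%:Z by lia.
congr (_ * _); rewrite -mulrA; congr (_ * _).
by apply: exprz_mulX; rewrite ?sqr_ge0 // qformZ PoszM.
Qed.

Definition jac3 (j : int) : F := (jacobi3 (j + 1))%:~R.

(** A difference of an indicator and its reflection: the oddness of the symbol becomes visible, and
    [lia] can handle it. *)
Lemma jacobi3_split j :
  jacobi3 j = (j == 1 %[mod 3])%Z%:Z - (- j == 1 %[mod 3])%Z%:Z.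
Proof. by rewrite /jacobi3; case: ifP => ?; [|case: ifP => ?]; lia. Qed.

Lemma jacobi3_sum0 j : jacobi3 (j - 1) + jacobi3 j + jacobi3 (j + 1) = 0.
Proof. by rewrite !jacobi3_split; lia. Qed.

Lemma jac3_sum0 j : jac3 (j - 1) + jac3 j + jac3 (j + 1) = 0.
Proof.
rewrite /jac3 -!intrD (_ : j - 1 + 1 = j + 1 - 1); last by lia.
by rewrite jacobi3_sum0.
Qed.

(** Exchanging r and s fixes the form and negates s - r. Antisymmetry alone gives 2S = 0, which says
    nothing in characteristic 2; so the symbol is split as nu(j) - nu(-j) and the two halves are
    shown equal. *)
Lemma sum_jac3_antisym N L :
  \sum_(r < N) \sum_(s < N) jac3 (s%:Z - r%:Z - 1) * q ^+ qform r s
    * (qbin q L r * qbin q L s) = 0.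
Proof.
pose nu (j : int) : F := (j == 1 %[mod 3])%Z%:Z%:~R.
pose S (w : int -> F) := \sum_(r < N) \sum_(s < N) w (s%:Z - r%:Z) * q ^+ qform r s
    * (qbin q L r * qbin q L s).
have -> : \sum_(r < N) \sum_(s < N) jac3 (s%:Z - r%:Z - 1) * q ^+ qform r s
    * (qbin q L r * qbin q L s) = S nu - S (fun j => nu (- j)).
  rewrite /S -sumrB; apply: eq_bigr => r _; rewrite -sumrB.
  apply: eq_bigr => s _; rewrite /jac3 subrK jacobi3_split intrB -/(nu _) -/(nu _).
  by ring.
rewrite /S (sum_qform_swap N L (fun r s => nu (s%:Z - r%:Z) * q ^+ qform r s)).
apply/eqP; rewrite subr_eq0; apply/eqP; apply: eq_bigr => r _.
by apply: eq_bigr => s _; rewrite opprB qformC.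
Qed.

Lemma sum_pronic_qbin N L : (2 * L + 2 < N)%N ->
  \sum_(k < N) jac3 (k%:Z - L%:Z)
    * q ^ ((k%:Z - L%:Z) * (k%:Z - L%:Z + 1)) * qbin q (2 * L) k =
  \sum_(r < N) \sum_(s < N)
    (jac3 (s%:Z - r%:Z) + jac3 (- 1 - (s%:Z - r%:Z))) * q ^+ (qform r s + s)
    * (qbin q L r * qbin q L s).
Proof.
move=> LN; pose h (j : int) := jac3 j * q ^ (j * (j + 1)).
pose T := \sum_(k < N) h (k%:Z - L%:Z - 1) * qbin q (2 * L).+1 k.
(* The q-Pascal rule shifts an index by one: [recl] isolates the first term of a sum, and [dropl]
   discards a last term that is 0. *)
have dropl (g : nat -> F) (n := N.-1) : g n = 0 ->
    \sum_(k < N) g k = \sum_(k < n) g k.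
  by move=> gn; rewrite (_ : N = n.+1) ?big_ord_recr /= ?gn ?addr0 //; lia.
have recl (g : nat -> F) (n := N.-1) :
    \sum_(k < N) g k = g 0%N + \sum_(k < n) g k.+1.
  by rewrite (_ : N = n.+1) ?big_ord_recl //; lia.
(* q-Pascal on [2L+1, k] yields the wanted sum plus terms with q^k [2L, k]. With j = k - L these
   have exponent j(j-1) + k = j^2 + L, so they form q^L times the antisymmetric sum. *)
have TL : T = \sum_(k < N) h (k%:Z - L%:Z) * qbin q (2 * L) k.
  transitivity (\sum_(k < N) h (k%:Z - L%:Z - 1) * (q ^+ k * qbin q (2 * L) k)
      + \sum_(k < N) h (k%:Z - L%:Z) * qbin q (2 * L) k).
    rewrite /T (recl (fun k => h (k%:Z - L%:Z - 1) * qbin q (2 * L).+1 k)).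
    rewrite (recl (fun k => h (k%:Z - L%:Z - 1) * (q ^+ k * qbin q (2 * L) k))).
    rewrite (dropl (fun k => h (k%:Z - L%:Z) * qbin q (2 * L) k)); last first.
      by rewrite qbin_small ?mulr0 //; lia.
    rewrite -[RHS]addrA -big_split !qbinn0 mul1r; congr (_ + _).
    apply: eq_bigr => k _; rewrite qbinSr // mulrDr; congr (_ + h _ * _); lia.
  rewrite [X in X + _](_ : _ = 0) ?add0r //.
  transitivity (q ^+ L * \sum_(k < N) jac3 (k%:Z - L%:Z - 1)
      * q ^ ((k%:Z - L%:Z) ^+ 2) * qbin q (2 * L) k).
    rewrite mulr_sumr; apply: eq_bigr => k _; rewrite /h.
    rewrite (_ : q ^+ L * _ = jac3 (k%:Z - L%:Z - 1)
      * (q ^ ((k%:Z - L%:Z) ^+ 2) * q ^+ L) * qbin q (2 * L) k); last by ring.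
    rewrite mulrA -!mulrA; congr (_ * _); rewrite !mulrA; congr (_ * _).
    set j := k%:Z - L%:Z.
    have [m mE] : exists m : nat, j ^+ 2 + L%:Z = m%:Z.
      by exists (absz (j ^+ 2 + L%:Z)); rewrite gez0_abs // addr_ge0 ?sqr_ge0.
    rewrite (exprz_mulX (sqr_ge0 _) mE) (@exprz_mulX _ _ m) //.
      by rewrite mulz_succ_ge0.
    by rewrite -mE /j; ring.
  rewrite (@sum_sq_qbin N L (fun j => jac3 (j - 1))); last by lia.
  by rewrite sum_jac3_antisym mulr0.
rewrite -TL /T (_ : (2 * L).+1 = L + L.+1)%N; last by lia.
rewrite (sum_qbin_vandermonde (fun k : nat => h (k%:Z - L%:Z - 1))); last by lia.
(* q-Pascal on [L+1, s] gives two sums, with exponents [qform r s + r] and [qform r s + s];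
   exchanging r and s in the first reflects its weight to -1 - (s - r). *)
transitivity (\sum_(r < N) \sum_(s < N) jac3 (s%:Z - r%:Z - 1) * q ^+ (qform r s + r)
    * (qbin q L r * qbin q L s)
  + \sum_(r < N) \sum_(s < N) jac3 (s%:Z - r%:Z) * q ^+ (qform r s + s)
    * (qbin q L r * qbin q L s)); last first.
  rewrite (sum_qform_swap N L (fun r s =>
    jac3 (s%:Z - r%:Z - 1) * q ^+ (qform r s + r))).
  rewrite -big_split; apply: eq_bigr => r _; rewrite -big_split.
  apply: eq_bigr => s _ /=; rewrite qformC.
  rewrite (_ : r%:Z - s%:Z - 1 = - 1 - (s%:Z - r%:Z)); last by lia.
  by ring.
rewrite -big_split; apply: eq_bigr => r _ /=.
have [Lr|rL] := ltnP L r.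
  by rewrite !big1 ?addr0 // => s _; rewrite (qbin_small q Lr) mul0r mulr0.
transitivity (\sum_(s < N) h (s%:Z - r%:Z - 1) * q ^+ (r * s)
    * (qbin q L r * qbin q L.+1 s)).
  by apply: eq_bigr => s _; congr (h _ * _ * _); lia.
rewrite (recl (fun s => h (s%:Z - r%:Z - 1) * q ^+ (r * s)
    * (qbin q L r * qbin q L.+1 s))).
rewrite (recl (fun s => jac3 (s%:Z - r%:Z - 1) * q ^+ (qform r s + r)
    * (qbin q L r * qbin q L s))).
rewrite (dropl (fun s => jac3 (s%:Z - r%:Z) * q ^+ (qform r s + s)
    * (qbin q L r * qbin q L s))); last first.
  by rewrite (@qbin_small _ _ L N.-1) ?mulr0 //; lia.
have hE (s : nat) : h (s%:Z - r%:Z - 1) * q ^+ (r * s + s) =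
    jac3 (s%:Z - r%:Z - 1) * q ^+ (qform r s + r).
  rewrite /h -mulrA; congr (_ * _); apply: exprz_mulX; first exact: mulz_succ_ge0.
  by rewrite (PoszD (qform _ _)) qformZ PoszD PoszM; ring.
rewrite -[RHS]addrA -big_split !qbinn0; congr (_ + _).
  by rewrite -hE addn0.
apply: eq_bigr => s _; rewrite qbinSr // -hE.
rewrite (_ : s.+1%:Z - r%:Z - 1 = s%:Z - r%:Z); last by lia.
rewrite (_ : jac3 (s%:Z - r%:Z) * q ^+ (qform r s + s)
    = h (s%:Z - r%:Z) * q ^+ (r * s.+1)).
  by rewrite exprD -[RHS]/(_ + _); ring.
rewrite /h -mulrA; congr (_ * _); apply/esym/exprz_mulX; first exact: mulz_succ_ge0.
by rewrite PoszD qformZ PoszM -addn1 PoszD; ring.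
Qed.

Lemma qpoch_inv_sub L x : qpoch_inv q (L%:Z - x%:Z) = qpochVsub q L x.
Proof.
rewrite /qpochVsub; case: leqP => h.
  by rewrite (_ : L%:Z - x%:Z = (L - x)%N%:Z) //; lia.
by rewrite (_ : L%:Z - x%:Z = Negz (x - L).-1) //; lia.
Qed.

Lemma fsum_qpoch (N L d : nat) (f : nat -> nat -> nat) : (L < N)%N ->
  \sum_(p \in [set: nat * nat])
    (let: (m, n) := p in
     q ^+ f m n * qpoch q q L * qpochVsub q L (3 * n + 2 * m + d)
       * qpoch_inv q m%:Z * qpoch_inv (q ^+ 3) n%:Z) =
  \sum_(m < N) \sum_(n < L.+1)
    q ^+ f m n * qpoch q q L * qpochVsub q L (3 * n + 2 * m + d)
      * qpochV q m * qpochV (q ^+ 3) n.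
Proof.
move=> LN; apply: fsum_nat2 => m n mn.
by rewrite qpochVsub_large ?mulr0 ?mul0r //; lia.
Qed.

Lemma fsum_qbinom (N L : nat) (w : int -> F) (f : int -> int) : (2 * L < N)%N ->
  \sum_(j \in [set j : int | - L%:Z <= j <= L%:Z])
    w j * q ^ f j * qbinom q (2 * L)%:Z (L%:Z - j) =
  \sum_(k < N) w (k%:Z - L%:Z) * q ^ f (k%:Z - L%:Z) * qbin q (2 * L) k.
Proof.
move=> LN; rewrite fsum_int_itv.
rewrite (eq_bigr (fun k : 'I_(2 * L).+1 =>
  w (k%:Z - L%:Z) * q ^ f (k%:Z - L%:Z) * qbin q (2 * L) k)); last first.
  move=> -[k /= kL] _; rewrite -qbinomE //; congr (_ * qbinom _ _ _); lia.
rewrite (big_ord_widen N (fun k : nat =>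
  w (k%:Z - L%:Z) * q ^ f (k%:Z - L%:Z) * qbin q (2 * L) k)) //.
rewrite big_mkcond; apply: eq_bigr => k _; case: ltnP => // h.
by rewrite qbin_small ?mulr0.
Qed.

End MainSums.

Theorem theorem8 (F : fieldType) (q : F)
    (q_not_root1 : forall k : nat, (0 < k)%N -> q ^+ k <> 1) (L : nat) :
  (\sum_(p \in [set: nat * nat])
     (let: (m, n) := p in
      q ^+ (2 * m ^ 2 + 6 * m * n + 6 * n ^ 2) * qpoch q q L
        * qpoch_inv q (L%:Z - (3 * n)%:Z - (2 * m)%:Z)
        * qpoch_inv q m%:Z * qpoch_inv (q ^+ 3) n%:Z)
   = \sum_(j \in [set j : int | - L%:Z <= j <= L%:Z])
       ((jacobi3 (j + 1))%:~R * q ^ (j ^+ 2)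
          * qbinom q (2 * L)%:Z (L%:Z - j)))
  /\
  (\sum_(p \in [set: nat * nat])
     (let: (m, n) := p in
      q ^+ (2 * m ^ 2 + 6 * m * n + 6 * n ^ 2 + m + 3 * n) * qpoch q q L
        * qpoch_inv q (L%:Z - (3 * n)%:Z - (2 * m)%:Z)
        * qpoch_inv q m%:Z * qpoch_inv (q ^+ 3) n%:Z)
   + q * \sum_(p \in [set: nat * nat])
     (let: (m, n) := p in
      q ^+ (2 * m ^ 2 + 6 * m * n + 6 * n ^ 2 + 3 * m + 6 * n) * qpoch q q L
        * qpoch_inv q (L%:Z - (3 * n)%:Z - (2 * m)%:Z - 1)
        * qpoch_inv q m%:Z * qpoch_inv (q ^+ 3) n%:Z)
   = \sum_(j \in [set j : int | - L%:Z <= j <= L%:Z])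
       ((jacobi3 (j + 1))%:~R * q ^ (j * (j + 1))
          * qbinom q (2 * L)%:Z (L%:Z - j))).
Proof.
(* One bound for all sums: a multiple of 3, as the collapse requires, and larger than 2L + 2. *)
pose N := (3 * L.+1)%N.
have LN : (L < N)%N by rewrite /N; lia.
have LN2 : (2 * L < N)%N by rewrite /N; lia.
have subE n m : L%:Z - (3 * n)%:Z - (2 * m)%:Z = L%:Z - (3 * n + 2 * m)%N%:Z.
  by lia.
have subE1 n m :
    L%:Z - (3 * n)%:Z - (2 * m)%:Z - 1 = L%:Z - (3 * n + 2 * m + 1)%N%:Z.
  by lia.
split.
  rewrite (fsum_qbinom q_not_root1 (jac3 F) (fun j => j ^+ 2) LN2).
  rewrite (sum_sq_qbin q_not_root1 (jac3 F) LN2).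
  rewrite (sum_qform_collapse0 q_not_root1 L (@jac3_sum0 F)) //.
  have := fsum_qpoch q 0 (fun m n => 2 * m ^ 2 + 6 * m * n + 6 * n ^ 2)%N LN.
  under [in RHS]eq_bigr => m _ do under eq_bigr => n _ do rewrite addn0.
  move=> <-; apply: eq_fsbigr => -[m n] _.
  by rewrite subE qpoch_inv_sub addn0.
rewrite (fsum_qbinom q_not_root1 (jac3 F) (fun j => j * (j + 1)) LN2).
rewrite (sum_pronic_qbin q_not_root1); last by rewrite /N; lia.
rewrite (sum_qform_collapse1 q_not_root1 L
  (w := fun j => jac3 F j + jac3 F (- 1 - j))); last 3 first.
(* The reflection j -> -1 - j maps three consecutive integers to three consecutive integers, so the
   symmetrised weight keeps the zero-sum property. *)
- move=> j; transitivity ((jac3 F (j - 1) + jac3 F j + jac3 F (j + 1)) +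
    (jac3 F (- 1 - j - 1) + jac3 F (- 1 - j) + jac3 F (- 1 - j + 1))).
    rewrite (_ : - 1 - (j - 1) = - 1 - j + 1); last by lia.
    by rewrite (_ : - 1 - (j + 1) = - 1 - j - 1); [ring|lia].
  by rewrite !jac3_sum0 addr0.
(* At 0 and at -1 the symmetrised weight is [jac3 0 + jac3 (-1)] in some order, that is 1 + 0. *)
- by rewrite /jac3 addr0.
- by rewrite /jac3 add0r.
congr (_ + q * _).
  have := fsum_qpoch q 0
    (fun m n => 2 * m ^ 2 + 6 * m * n + 6 * n ^ 2 + m + 3 * n)%N LN.
  under [in RHS]eq_bigr => m _ do under eq_bigr => n _ do rewrite addn0.
  move=> <-; apply: eq_fsbigr => -[m n] _.
  by rewrite subE qpoch_inv_sub addn0.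
rewrite -(fsum_qpoch q 1
  (fun m n => 2 * m ^ 2 + 6 * m * n + 6 * n ^ 2 + 3 * m + 6 * n)%N LN).
by apply: eq_fsbigr => -[m n] _; rewrite subE1 qpoch_inv_sub.
Qed.
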